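(* Let $(G,g)$ be a four-dimensional Lie group with left-invariant Lorentzian metric $g$, whose Lie algebra $\mathfrak g$ has a pseudo-orthonormal basis $\{e_1,e_2,e_3,e_4\}$ with $e_3$ time-like. Case (2): Suppose $\mathfrak g$ has the brackets of case (2) in the context with $\epsilon=-1$, $\delta=1$, and let $V=c(e_2+e_3-e_4)$ with $c\neq0$. Then $V$ defines a harmonic map if and only if $A=-B$. Case (3): Suppose $\mathfrak g$ has the brackets of case (3) in the context, and let $V=ae_1+be_2+ce_3+de_4$ be any nonzero left-invariant vector field, $a,b,c,d\in\mathbb R$. Then $V$ defines a harmonic map if and only if $A=\pm B$.
   Context: Metric: $g(e_1,e_1)=g(e_2,e_2)=g(e_4,e_4)=1$, $g(e_3,e_3)=-1$, and $g(e_i,e_j)=0$ for $i\ne j$; $\varepsilon_i=g(e_i,e_i)$. Brackets (only nonzero ones, up to antisymmetry; $\epsilon=\pm1$, $\delta=\pm1$, $A,B$ real constants for which the expressions are defined and real): (2) $[e_1,e_2]=\frac{\epsilon\sqrt{A^2-B^2}}{2}e_1$, $[e_1,e_3]=-\frac{\epsilon\delta\sqrt{A^2-B^2}}{2}e_1$, $[e_1,e_4]=\frac{\delta A+B}{2}e_1$, $[e_2,e_4]=B(e_2+\delta e_3)$, $[e_3,e_4]=A(e_2+\delta e_3)$. (3) $[e_1,e_2]=\frac{\epsilon A\sqrt{A^2-B^2}}{B}e_1$, $[e_1,e_3]=\epsilon\sqrt{A^2-B^2}\,e_1$, $[e_2,e_4]=Be_2-Ae_3$, $[e_3,e_4]=Ae_2-\frac{A^2}{B}e_3$.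 $\nabla$ is the Levi-Civita connection and $R(X,Y)=\nabla_{[X,Y]}-[\nabla_X,\nabla_Y]$. A vector field $V$ defines a harmonic map (from $(G,g)$ to $TG$ with the Sasaki metric) if and only if $$\mathrm{tr}[R(\nabla_\cdot V,V)\cdot]=\sum_i\varepsilon_iR(\nabla_{e_i}V,V)e_i=0\quad\text{and}\quad\nabla^*\nabla V=\sum_i\varepsilon_i\left(\nabla_{e_i}\nabla_{e_i}V-\nabla_{\nabla_{e_i}e_i}V\right)=0;$$ this is taken as the definition. *)

(* Defs.v *)
From mathcomp Require Import all_boot all_order all_algebra.
From mathcomp Require Import reals.

Set Implicit Arguments.
Unset Strict Implicit.
Unset Printing Implicit Defensive.

Import Order.TTheory GRing.Theory Num.Theory.

Local Open Scope ring_scope.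

(* The Lie algebra L of a Lie group G is identified with the space of
   left-invariant vector fields on G.  A left-invariant metric is then a
   symmetric bilinear form g on L, and the Levi-Civita connection maps pairs of
   left-invariant fields to left-invariant fields, so that it restricts to a
   bilinear map nabla on L. *)

Section LeftInvariantGeometry.

Variables (R : realType) (L : vectType R).

Definition is_lie_bracket (br : {bilinear L -> L -> L}) : Prop :=
  (forall X, br X X = 0) /\
  (forall X Y Z, br X (br Y Z) + br Y (br Z X) + br Z (br X Y) = 0).

Definition torsion_free (br nabla : {bilinear L -> L -> L}) : Prop :=
  forall X Y, nabla X Y - nabla Y X = br X Y.

(* The general condition is X (g Y Z) = g (nabla X Y) Z + g Y (nabla X Z); the
   left-hand side vanishes because g Y Z is a constant function on G. *)
Definition metric_compatible (g : {symmetric L})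
    (nabla : {bilinear L -> L -> L}) : Prop :=
  forall X Y Z, g (nabla X Y) Z + g Y (nabla X Z) = 0.

Definition is_levi_civita (br : {bilinear L -> L -> L}) (g : {symmetric L})
    (nabla : {bilinear L -> L -> L}) : Prop :=
  torsion_free br nabla /\ metric_compatible g nabla.

(* Sign convention: R(X, Y) = nabla_[X, Y] - [nabla_X, nabla_Y]. *)
Definition curvature (br nabla : {bilinear L -> L -> L}) (X Y Z : L) : L :=
  nabla (br X Y) Z - (nabla X (nabla Y Z) - nabla Y (nabla X Z)).

(* In the next three definitions e lists a pseudo-orthonormal basis, so that
   g x x is the sign attached to the basis vector x. *)
Definition curvature_trace (br : {bilinear L -> L -> L}) (g : {symmetric L})
    (nabla : {bilinear L -> L -> L}) (e : seq L) (V : L) : L :=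
  \sum_(x <- e) g x x *: curvature br nabla (nabla x V) V x.

Definition rough_laplacian (g : {symmetric L})
    (nabla : {bilinear L -> L -> L}) (e : seq L) (V : L) : L :=
  \sum_(x <- e) g x x *: (nabla x (nabla x V) - nabla (nabla x x) V).

Definition defines_harmonic_map (br : {bilinear L -> L -> L})
    (g : {symmetric L}) (nabla : {bilinear L -> L -> L}) (e : seq L) (V : L)
    : Prop :=
  curvature_trace br g nabla e V = 0 /\ rough_laplacian g nabla e V = 0.

(* Signature (+, +, -, +): e3 is the time-like vector. *)
Definition pseudo_orthonormal_basis (g : {symmetric L}) (e1 e2 e3 e4 : L)
    : Prop :=
  [/\ basis_of fullv [:: e1; e2; e3; e4],
      [/\ g e1 e1 = 1, g e2 e2 = 1, g e3 e3 = -1 & g e4 e4 = 1] &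
      [/\ g e1 e2 = 0, g e1 e3 = 0 & g e1 e4 = 0] /\
      [/\ g e2 e3 = 0, g e2 e4 = 0 & g e3 e4 = 0]].

Definition brackets2 (br : {bilinear L -> L -> L}) (e1 e2 e3 e4 : L)
    (epsilon delta A B : R) : Prop :=
  let s := Num.sqrt (A ^+ 2 - B ^+ 2) in
  [/\ br e1 e2 = (epsilon * s / 2) *: e1,
      br e1 e3 = - (epsilon * delta * s / 2) *: e1 &
      br e1 e4 = ((delta * A + B) / 2) *: e1] /\
  [/\ br e2 e3 = 0,
      br e2 e4 = B *: (e2 + delta *: e3) &
      br e3 e4 = A *: (e2 + delta *: e3)].

Definition brackets3 (br : {bilinear L -> L -> L}) (e1 e2 e3 e4 : L)
    (epsilon A B : R) : Prop :=
  let s := Num.sqrt (A ^+ 2 - B ^+ 2) in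
  [/\ br e1 e2 = (epsilon * A * s / B) *: e1,
      br e1 e3 = (epsilon * s) *: e1 &
      br e1 e4 = 0] /\
  [/\ br e2 e3 = 0,
      br e2 e4 = B *: e2 - A *: e3 &
      br e3 e4 = A *: e2 - (A ^+ 2 / B) *: e3].

End LeftInvariantGeometry.

(* Main.v *)
(** In the frame e1, ..., e4 the Koszul formula determines nabla completely, so
    both harmonicity conditions become polynomial identities in the structure
    constants.  Writing s^2 = A^2 - B^2, the rough Laplacian is
    -3/4 (A + B)^2 V in case (2) and -(s^4 / B^2) V in case (3), which forces
    A = -B, respectively A^2 = B^2, because V is nonzero.  Conversely, under these
    conditions s vanishes, nabla is flat and its rough Laplacian is zero. *)
Require Import Defs.
From mathcomp Require Import all_boot all_order all_algebra.
From mathcomp Require Import reals.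
From mathcomp Require Import ring lra.

Set Implicit Arguments.
Unset Strict Implicit.
Unset Printing Implicit Defensive.

Import Order.TTheory GRing.Theory Num.Theory.

Local Open Scope ring_scope.

Section Frame.

Variables (R : realType) (L : vectType R).
Variables (br : {bilinear L -> L -> L}) (g : {symmetric L}).
Variables (nabla : {bilinear L -> L -> L}) (e1 e2 e3 e4 : L).
Hypothesis he : pseudo_orthonormal_basis g e1 e2 e3 e4.
Hypothesis hnabla : is_levi_civita br g nabla.

Lemma metricC X Y : g X Y = g Y X.
Proof. by rewrite hermC expr0 mul1r. Qed.

Lemma bracket_anti X Y : br X Y = - br Y X.
Proof. by rewrite -!(proj1 hnabla) opprB. Qed.

Lemma bracket_self X : br X X = 0.
Proof. by rewrite -(proj1 hnabla) subrr. Qed.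

(** Left-invariant inner products are constant, so the derivative terms of the Koszul formula drop
    out. What remains is a combination of metric compatibility for the three cyclic permutations of
    [X], [Y], [Z], with brackets expressed through torsion-freeness. *)
Lemma koszul X Y Z :
  g (nabla X Y) Z = (g (br X Y) Z - g (br Y Z) X + g (br Z X) Y) / 2.
Proof.
case: hnabla => tf mc; rewrite -!tf !linearBl /=.
have := mc X Y Z; have := mc Y Z X; have := mc Z X Y.
rewrite (metricC Y) (metricC Z) (metricC X); lra.
Qed.

Definition comb (x y z t : R) : L := x *: e1 + y *: e2 + z *: e3 + t *: e4.

Lemma combD x y z t x' y' z' t' :
  comb x y z t + comb x' y' z' t' = comb (x + x') (y + y') (z + z') (t + t').
Proof.
rewrite /comb !scalerDl addrACA; congr (_ + _).
by rewrite addrACA; congr (_ + _); rewrite addrACA.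
Qed.

Lemma combZ k x y z t :
  k *: comb x y z t = comb (k * x) (k * y) (k * z) (k * t).
Proof. by rewrite /comb !scalerDr !scalerA. Qed.

Lemma combN x y z t : - comb x y z t = comb (- x) (- y) (- z) (- t).
Proof. by rewrite -scaleN1r combZ !mulN1r. Qed.

Lemma comb0 : comb 0 0 0 0 = 0.
Proof. by rewrite /comb !scale0r !addr0. Qed.

Lemma frameE : [/\ e1 = comb 1 0 0 0, e2 = comb 0 1 0 0,
  e3 = comb 0 0 1 0 & e4 = comb 0 0 0 1].
Proof. by rewrite /comb !scale0r !scale1r !addr0 !add0r. Qed.

Lemma metric_comb x y z t x' y' z' t' :
  g (comb x y z t) (comb x' y' z' t') = x * x' + y * y' - z * z' + t * t'.
Proof.
case: he => _ [g11 g22 g33 g44] [[g12 g13 g14] [g23 g24 g34]].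
rewrite /comb !linearDl /= !linearDr /= !linearZl_LR /= !linearZr_LR /=.
rewrite (metricC e2 e1) (metricC e3 e1) (metricC e4 e1) (metricC e3 e2).
rewrite (metricC e4 e2) (metricC e4 e3).
rewrite g11 g22 g33 g44 g12 g13 g14 g23 g24 g34 /=; ring.
Qed.

Lemma comb_surj X : exists x y z t, X = comb x y z t.
Proof.
have [bas _] := he.
have := coord_basis (X := [tuple e1; e2; e3; e4]) bas (memvf X).
rewrite !big_ord_recl big_ord0 /= addr0 !addrA => ->.
by do 4!eexists.
Qed.

(** Pairing with the frame vectors recovers each coordinate up to the sign of the metric. *)
Lemma comb_inj x y z t x' y' z' t' :
  comb x y z t = comb x' y' z' t' -> [/\ x = x', y = y', z = z' & t = t'].
Proof.
move=> E; have E' a b c d := congr1 (fun X => g X (comb a b c d)) E.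
move: (E' 1 0 0 0) (E' 0 1 0 0) (E' 0 0 1 0) (E' 0 0 0 1).
by rewrite !metric_comb => *; split; lra.
Qed.

Lemma metric_nondegenerate X Y :
  (forall x y z t, g X (comb x y z t) = g Y (comb x y z t)) -> X = Y.
Proof.
have [x [y [z [t ->]]]] := comb_surj X.
have [x' [y' [z' [t' ->]]]] := comb_surj Y => E.
move: (E 1 0 0 0) (E 0 1 0 0) (E 0 0 1 0) (E 0 0 0 1).
by rewrite !metric_comb => *; congr comb; lra.
Qed.

(* The brackets of cases (2) and (3) are both of the following shape. *)
Variables p q r u v w k : R.
Hypothesis hbr1 : [/\ br e1 e2 = p *: e1, br e1 e3 = q *: e1 &
  br e1 e4 = r *: e1].
Hypothesis hbr2 : [/\ br e2 e3 = 0, br e2 e4 = u *: e2 + v *: e3 &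
  br e3 e4 = w *: e2 + k *: e3].

Lemma bracket_comb x y z t x' y' z' t' :
  br (comb x y z t) (comb x' y' z' t') =
  comb (x * (p * y' + q * z' + r * t') - x' * (p * y + q * z + r * t))
       (u * (y * t' - t * y') + w * (z * t' - t * z'))
       (v * (y * t' - t * y') + k * (z * t' - t * z')) 0.
Proof.
have [E1 E2 E3 E4] := frameE.
have [b12 b13 b14] := hbr1; have [b23 b24 b34] := hbr2.
rewrite {1 2}/comb !linearDl /= !linearDr /= !linearZl_LR /= !linearZr_LR /=.
rewrite !bracket_self (bracket_anti e2 e1) (bracket_anti e3 e1).
rewrite (bracket_anti e4 e1) (bracket_anti e3 e2) (bracket_anti e4 e2).
rewrite (bracket_anti e4 e3) b12 b13 b14 b23 b24 b34 E1 E2 E3 -comb0.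
rewrite !(combZ, combD, combN); congr comb; ring.
Qed.

(** The Koszul formula gives the inner product of [nabla X Y] with every vector, and nondegeneracy
    of [g] turns this into coordinates. *)
Lemma nabla_comb x y z t x' y' z' t' :
  nabla (comb x y z t) (comb x' y' z' t') =
  comb (x * (p * y' + q * z' + r * t'))
       (- p * x * x' + u * y * t' + (w - v) / 2 * z * t' - (v + w) / 2 * t * z')
       (q * x * x' + (v - w) / 2 * y * t' + k * z * t' - (v + w) / 2 * t * y')
       (- r * x * x' - u * y * y' + (v - w) / 2 * (y * z' + z * y')
        + k * z * z').
Proof.
apply: metric_nondegenerate => a b c d.
rewrite koszul !bracket_comb !metric_comb; by field.
Qed.


(** For V with coordinates [a b c d], [f] is the [e1] coordinate of nabla_e1 V, while
    [- (u * b + n * c)] and [- (n * b - k * c)] are the [e4] coordinates of nabla_e2 V and nabla_e3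
    V. The map nabla_e4 swaps [e2] and [e3] up to the factor [- m], and [- h] is the [e4] coordinate
    of the signed sum of the nabla_ei ei. *)
Lemma rough_laplacian_comb a b c d :
  let f := p * b + q * c + r * d in let m := (v + w) / 2 in
  let n := (w - v) / 2 in let h := r + u + k in
  rough_laplacian g nabla [:: e1; e2; e3; e4] (comb a b c d) =
  comb ((q ^+ 2 - p ^+ 2 - r ^+ 2) * a)
       (- p * f - u * (u * b + n * c) + n * (n * b - k * c) + m ^+ 2 * b
        + (u * p - n * q) * d - m * h * c)
       (q * f + n * (u * b + n * c) + k * (n * b - k * c) + m ^+ 2 * c
        - (n * p + k * q) * d - m * h * b)
       (- r * f + (2 * n ^+ 2 - u ^+ 2 - k ^+ 2) * d
        - p * (u * b + n * c) + q * (n * b - k * c)).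
Proof.
move=> f m n h; have [E1 E2 E3 E4] := frameE.
rewrite /rough_laplacian !big_cons big_nil addr0 E1 E2 E3 E4.
rewrite !nabla_comb !metric_comb !(combZ, combD, combN).
rewrite /f /m /n /h; congr comb; by field.
Qed.

(** Here nabla_e1 = nabla_e4 = 0, and nabla_e3 is plus or minus nabla_e2, so all these operators
    commute. Every bracket is a multiple of the null vector [u *: e2 + v *: e3], along which nabla
    vanishes too. *)
Lemma curvature_eq0 X Y Z :
  p = 0 -> q = 0 -> r = 0 -> w = - v -> k = - u -> v ^+ 2 = u ^+ 2 ->
  curvature br nabla X Y Z = 0.
Proof.
move=> p0 q0 r0 wE kE vE.
have [x [y [z [t ->]]]] := comb_surj X.
have [x' [y' [z' [t' ->]]]] := comb_surj Y.
have [a [b [c [d ->]]]] := comb_surj Z.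
rewrite /curvature !bracket_comb !nabla_comb !(combN, combD) -comb0.
rewrite p0 q0 r0 wE kE; congr comb; by field: vE.
Qed.

(** This serves both converses. Flatness kills the curvature trace; in the rough Laplacian [m] and
    [h] vanish, and each remaining coefficient is a multiple of [v ^+ 2 - u ^+ 2]. *)
Lemma harmonic_of_flat V :
  p = 0 -> q = 0 -> r = 0 -> w = - v -> k = - u -> v ^+ 2 = u ^+ 2 ->
  defines_harmonic_map br g nabla [:: e1; e2; e3; e4] V.
Proof.
move=> p0 q0 r0 wE kE vE; split.
  rewrite /curvature_trace big1_seq // => X _.
  by rewrite curvature_eq0 ?scaler0.
have [a [b [c [d ->]]]] := comb_surj V.
rewrite rough_laplacian_comb -comb0 p0 q0 r0 wE kE.
congr comb; by field: vE.
Qed.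

End Frame.

Theorem theorem3p3 (R : realType) (L : vectType R)
    (br : {bilinear L -> L -> L}) (g : {symmetric L})
    (nabla : {bilinear L -> L -> L}) (e1 e2 e3 e4 : L)
    (hbr : is_lie_bracket br)
    (he : pseudo_orthonormal_basis g e1 e2 e3 e4)
    (hnabla : is_levi_civita br g nabla) :
  (forall A B c : R,
      0 <= A ^+ 2 - B ^+ 2 ->
      brackets2 br e1 e2 e3 e4 (-1) 1 A B ->
      c != 0 ->
      defines_harmonic_map br g nabla [:: e1; e2; e3; e4]
        (c *: (e2 + e3 - e4)) <-> A = - B)
  /\
  (forall epsilon A B a b c d : R,
      epsilon = 1 \/ epsilon = -1 ->
      0 <= A ^+ 2 - B ^+ 2 ->
      B != 0 ->
      brackets3 br e1 e2 e3 e4 epsilon A B ->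
      let V := a *: e1 + b *: e2 + c *: e3 + d *: e4 in
      V != 0 ->
      defines_harmonic_map br g nabla [:: e1; e2; e3; e4] V <->
        (A = B \/ A = - B)).
Proof.
split=> [A B c AB hb c0|eps A B a b c d epsE AB B0 hb V V0].
(* [Num.sqrt] is 0 on negative numbers; [AB] makes [s] a genuine root. *)
- have s2 := sqr_sqrtr AB; set s := Num.sqrt _ in s2.
  have hb1 : [/\ br e1 e2 = (- (s / 2)) *: e1, br e1 e3 = (s / 2) *: e1 &
      br e1 e4 = ((A + B) / 2) *: e1].
    case: hb => [[-> -> ->]] _; rewrite -/s.
    by split; congr (_ *: _); field.
  have hb2 : [/\ br e2 e3 = 0, br e2 e4 = B *: e2 + B *: e3 &
      br e3 e4 = A *: e2 + A *: e3].
    by case: hb => _ [-> -> ->]; rewrite scale1r !scalerDr.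
  split=> [[_]|AE].
    have -> : c *: (e2 + e3 - e4) = comb e1 e2 e3 e4 0 c c (- c).
      by rewrite /comb scale0r add0r scaleNr !scalerDr scalerN.
    rewrite (rough_laplacian_comb he hnabla hb1 hb2) -(comb0 e1 e2 e3 e4).
    (* In the [e4] coordinate, [- r * f] gives 1/4 and [2 * n ^+ 2 - u ^+ 2 - k ^+ 2] gives 1/2 of
       [c * (A + B) ^+ 2]; the two terms linear in [s] cancel. *)
    case/(comb_inj he) => _ _ _ E.
    have : 3 / 4 * c * (A + B) ^+ 2 = 0 by rewrite -E; field: s2.
    move/eqP; rewrite mulf_eq0 sqrf_eq0 addr_eq0 => /orP[|/eqP //].
    by rewrite mulf_eq0 (negbTE c0) orbF; lra.
  have s0 : s = 0 by apply/eqP; rewrite -sqrf_eq0 s2 AE sqrrN subrr.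
  by apply: (harmonic_of_flat he hnabla hb1 hb2);
    rewrite ?s0 ?AE ?addNr ?mul0r ?oppr0.
- have s2 := sqr_sqrtr AB; set s := Num.sqrt _ in s2.
  have eps2 : eps ^+ 2 = 1 by case: epsE => ->; ring.
  have hb1 : [/\ br e1 e2 = (eps * A * s / B) *: e1,
      br e1 e3 = (eps * s) *: e1 & br e1 e4 = 0 *: e1].
    by case: hb => [[-> -> ->]] _; rewrite -/s scale0r.
  have hb2 : [/\ br e2 e3 = 0, br e2 e4 = B *: e2 + (- A) *: e3 &
      br e3 e4 = A *: e2 + (- (A ^+ 2 / B)) *: e3].
    by case: hb => _ [-> -> ->]; rewrite !scaleNr.
  split=> [[_]|AE].
    have VE : V = comb e1 e2 e3 e4 a b c d by [].
    rewrite VE (rough_laplacian_comb he hnabla hb1 hb2).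
    set X := comb _ _ _ _ _ _ _ _.
    (* The Laplacian is scalar on all left-invariant fields: [m], [u * p - n * q] and
       [n * p + k * q] vanish, which decouples [d], and the [b], [c] cross terms cancel by [s2]. *)
    have -> : X = - ((A ^+ 2 - B ^+ 2) ^+ 2 / B ^+ 2) *: V.
      rewrite VE combZ /X; congr comb; by field: s2 eps2.
    move/eqP; rewrite scaler_eq0 (negbTE V0) orbF oppr_eq0 mulf_eq0 invr_eq0.
    by rewrite !sqrf_eq0 (negbTE B0) orbF subr_eq0 eqf_sqr =>
      /orP[]/eqP; [left|right].
  have A2 : A ^+ 2 = B ^+ 2 by case: AE => ->; rewrite ?sqrrN.
  have s0 : s = 0 by apply/eqP; rewrite -sqrf_eq0 s2 A2 subrr.
  (* With [A ^+ 2 = B ^+ 2], the coefficient [- (A ^+ 2 / B)] becomes [- B], as the condition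
     [k = - u] demands. *)
  apply: (harmonic_of_flat he hnabla hb1 hb2); rewrite ?s0 ?A2 ?opprK ?sqrrN //;
    by field.
Qed.
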